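(* Let $t\ge 2$ be an integer and $n=4t^2$. For $w\le n$ let $A_w$ denote the number of codewords of Hamming weight $w$ in the order-$1$ FDPC code $\mathcal{C}_b$ with parity-check matrix $H_b$. Then for any such $n$ and any positive integer $w\le n$, $$A_w\le \sum_{(a_4,a_6,\dots,a_{4t})}\ \prod_{\substack{4\le m\le 4t\\ m\text{ even}}}\binom{A^{(\mathrm{ir})}_m}{a_m},$$ where the summation is over all tuples of non-negative integers $a_4,a_6,\dots,a_{4t}$ (indexed by even $m$, $4\le m\le 4t$) with $\sum_{m} m\,a_m=w$.
   Context: For an integer $t\ge 2$ and $n=4t^2$, the base parity-check matrix $H_b$ is the binary $4t\times n$ matrix whose columns are all the binary column vectors of length $4t$ and Hamming weight two such that the indices of the two non-zero entries differ by an odd number (each such vector appearing exactly once, in some fixed order). The order-$1$ FDPC code is $\mathcal{C}_b=\{c\in\mathbb{F}_2^n : H_b c^{T}=0\}$. For even $m$ with $4\le m\le 4t$, $$A^{(\mathrm{ir})}_m := \frac{1}{m}\prod_{i=0}^{m/2-1}(2t-i)^2,$$ which is a positive integer (it is the number of weight-$m$ codewords of $\mathcal{C}_b$ whose support, together with the neighboring check nodes, induces a single simple cycle in the Tanner graph of $H_b$). *)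

(* Defs.v *)
From HB Require Import structures.
From mathcomp Require Import all_boot all_order all_algebra.

Set Implicit Arguments.
Unset Strict Implicit.
Unset Printing Implicit Defensive.

Import GRing.Theory.

Definition hweight (n : nat) (c : 'rV['F_2]_n) : nat :=
  #|[set j | c ord0 j != 0%R]|.

(* [i2 - i1] is only used for [i1 < i2], so truncation plays no role. *)
Definition odd_gap_pair (r : nat) (v : 'cV['F_2]_r) : Prop :=
  hweight v^T = 2 /\
  forall i1 i2 : 'I_r, v i1 ord0 != 0%R -> v i2 ord0 != 0%R ->
    i1 < i2 -> odd (i2 - i1).

(* The order of the columns is left free: [H] is any matrix listing each
   admissible column exactly once. *)
Definition base_pcm (r n : nat) (H : 'M['F_2]_(r, n)) : Prop :=
  injective (fun j => col j H) /\
  forall v : 'cV['F_2]_r, odd_gap_pair v <-> exists j, v = col j H.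

Definition code_of (r n : nat) (H : 'M['F_2]_(r, n)) : {set 'rV['F_2]_n} :=
  [set c | (H *m c^T)%R == 0%R].

Definition num_codewords (n : nat) (C : {set 'rV['F_2]_n}) (w : nat) : nat :=
  #|[set c in C | hweight c == w]|.

(* For even [4 <= m <= 4 * t] no subtraction truncates and the division is
   exact. *)
Definition Air (t m : nat) : nat :=
  (\prod_(0 <= i < m./2) (2 * t - i) ^ 2) %/ m.

Lemma dvdn_Air (t m : nat) : ~~ odd m -> 4 <= m ->
  m %| \prod_(0 <= i < m./2) (2 * t - i) ^ 2.
Proof.
move=> m_even m_ge4; set k := m./2.
have mE : m = k * 2 by rewrite muln2 /k -[LHS]odd_double_half (negbTE m_even).
have k_ge2 : 2 <= k by move: m_ge4; rewrite mE; case: (k) => [|[|]].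
have -> : \prod_(0 <= i < k) (2 * t - i) ^ 2 = ((2 * t) ^_ k) ^ 2.
  rewrite big_mkord ffact_prod.
  by rewrite -(big_morph (expn^~ 2) (fun x y => expnMn x y 2) (exp1n 2)).
rewrite mE expnS expn1 -bin_ffact; apply: dvdn_mul; apply: dvdn_mull.
  by apply: dvdn_fact; rewrite leqnn andbT (leq_trans _ k_ge2).
by apply: dvdn_fact.
Qed.

(* The index [k : 'I_(2 * t).-1] stands for [m = cyc_len k], which runs over the
   even numbers from 4 to [4 * t]. *)
Definition cyc_len (k : nat) : nat := 2 * k + 4.

(* Entries are bounded by [w] so that the tuples form a finite type; nothing is
   lost, since [cyc_len k * a k <= w] forces [a k <= w]. *)
Definition weight_profiles (t w : nat) : {set {ffun 'I_(2 * t).-1 -> 'I_w.+1}} :=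
  [set a : {ffun 'I_(2 * t).-1 -> 'I_w.+1} |
    \sum_(k < (2 * t).-1) cyc_len k * a k == w].

(* Main.v *)
(* Each column of the parity-check matrix is an edge of the complete bipartite
   graph between the odd and the even check nodes, so codewords are edge sets in
   which every vertex has even degree. The end of a longest path in such a set
   has a second neighbour, necessarily on the path, which closes a simple cycle;
   removing cycles one at a time partitions the set into cycles. A codeword is
   recovered from its partition as the union of the parts, so it remains to count
   sets of cycles by their length profile. There are at most [Air t m] cycles of
   length [m = 2k]: each of the [m] edges of a cycle starts a traversal of it
   from an odd node, and a traversal amounts to two duplicate-free [k]-tuples,
   one of odd and one of even nodes. *)
Require Import Defs.
From mathcomp Require Import all_boot all_order all_algebra.
Set Implicit Arguments.
Unset Strict Implicit.
Unset Printing Implicit Defensive.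

(** * Cycles in graphs with even degrees *)

Section CycleEdges.
Variable W : finType.
Implicit Types (s : seq W) (C D : {set {set W}}) (u v : W).

(* [s] lists the vertices in cyclic order; the result is a simple cycle only for
   [uniq s] and [2 < size s]. *)
Definition cycle_edges s : {set {set W}} := [set [set u; next s u] | u in s].

Definition vertex_degree D v := #|[set e in D | v \in e]|.

Definition even_edges D := [forall v, ~~ odd (vertex_degree D v)].

(** The hypothesis [2 < size s] enters here: on two vertices the second step would return along the
    same edge. *)
Lemma next_next_neq s u : uniq s -> 2 < size s -> u \in s ->
  next s (next s u) != u.
Proof.
move=> s_uniq s_size /rot_to[i s' rotE].
rewrite -!(next_rot i s_uniq) rotE.
have : uniq (u :: s') by rewrite -rotE rot_uniq.
have : 2 < size (u :: s') by rewrite -rotE size_rot.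
case: s' {rotE} => [|v [|w s']] //= _ /and3P[].
rewrite !inE !negb_or => /and3P[uv uw _] _ _.
by rewrite ?eqxx (eq_sym v) ?(negbTE uv) ?eqxx eq_sym.
Qed.

(** If distinct vertices gave the same edge, each would be the successor of the other, against
    [next_next_neq]. *)
Lemma edge_next_inj s : uniq s -> 2 < size s ->
  {in s &, injective (fun u => [set u; next s u])}.
Proof.
move=> s_uniq s_size u v us vs /= E.
have := set21 u (next s u); rewrite E !inE => /orP[/eqP //|/eqP uE].
have := set21 v (next s v); rewrite -E !inE => /orP[/eqP //|/eqP vE].
by have := next_next_neq s_uniq s_size us; rewrite -vE -uE eqxx.
Qed.

Lemma card_cycle_edges s : uniq s -> 2 < size s -> #|cycle_edges s| = size s.
Proof.
move=> s_uniq s_size; rewrite card_in_imset; last exact: edge_next_inj.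
exact/card_uniqP.
Qed.

(** A vertex [v] of the cycle lies on exactly two edges, those starting at [v] and at [prev s v];
    any other vertex lies on none. *)
Lemma even_cycle_edges s : uniq s -> 2 < size s -> even_edges (cycle_edges s).
Proof.
move=> s_uniq s_size; apply/forallP => v; rewrite /vertex_degree.
have -> : [set e in cycle_edges s | v \in e] =
    [set [set u; next s u] | u in [set u in s | v \in [set u; next s u]]].
  apply/setP => e; rewrite inE; apply/andP/imsetP.
    by case=> /imsetP[u us ->] ve; exists u => //; rewrite inE us.
  by case=> u; rewrite inE => /andP[us vu] ->; split=> //; apply/imsetP; exists u.
rewrite card_in_imset; last first.
  by move=> u u'; rewrite !inE => /andP[? _] /andP[? _]; apply: edge_next_inj.
have [vs|vs] := boolP (v \in s); last first.
  rewrite (_ : [set _ in _ | _] = set0) ?cards0 //; apply/setP => u.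
  rewrite !inE; apply/negP => /andP[us /orP[]/eqP vE]; case/negP: vs.
    by rewrite vE.
  by rewrite vE mem_next.
rewrite (_ : [set _ in _ | _] = [set v; prev s v]); last first.
  apply/setP => u; rewrite !inE; have [->|uv] := eqVneq u v.
    by rewrite vs.
  rewrite /=; apply/andP/eqP.
    by case=> us /eqP->; rewrite prev_next.
  by move=> ->; rewrite mem_prev next_prev.
rewrite cards2 (_ : v != prev s v) //; apply/eqP => vE.
have vN : next s v = v by rewrite {1}vE next_prev.
by have := next_next_neq s_uniq s_size vs; rewrite !vN eqxx.
Qed.

Lemma even_edgesD D C : C \subset D -> even_edges D -> even_edges C ->
  even_edges (D :\: C).
Proof.
move=> CD /forallP evD /forallP evC; apply/forallP => v.
have : vertex_degree D v = vertex_degree C v + vertex_degree (D :\: C) v.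
  rewrite /vertex_degree -(cardsID C); congr (_ + _); apply: eq_card => e.
    rewrite !inE; have [/(subsetP CD)->|_] := boolP (e \in C);
      by rewrite ?andbT ?andbF.
  by rewrite !inE andbA.
by move=> /(congr1 odd); rewrite oddD (negbTE (evD v)) (negbTE (evC v)) /= => <-.
Qed.

Lemma cycle_edges_rot i s : uniq s -> cycle_edges (rot i s) = cycle_edges s.
Proof.
move=> s_uniq; apply/setP => e; apply/imsetP/imsetP => -[u].
  by rewrite mem_rot next_rot // => us ->; exists u.
by move=> us ->; exists u; rewrite ?mem_rot ?next_rot.
Qed.

Lemma cycle_edges_rev s : uniq s -> cycle_edges (rev s) = cycle_edges s.
Proof.
move=> s_uniq; apply/setP => e; apply/imsetP/imsetP => -[u].
  rewrite mem_rev next_rev // => us ->; exists (prev s u); rewrite ?mem_prev //.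
  by rewrite next_prev // setUC.
move=> us ->; exists (next s u); rewrite ?mem_rev ?mem_next //.
by rewrite next_rev // prev_next // setUC.
Qed.

(** The degree of [u] is positive and even, so a second edge contains [u]; being a different set of
    two vertices, it ends neither at [u] nor at [v]. *)
Lemma second_neighbour D u v : (forall e, e \in D -> #|e| = 2) ->
  even_edges D -> [set u; v] \in D ->
  exists2 w, [set u; w] \in D & (w != u) && (w != v).
Proof.
move=> D2 /forallP/(_ u) degu uvD.
have : [set e in D | u \in e] != [set [set u; v]].
  by apply: contra degu => /eqP; rewrite /vertex_degree => ->; rewrite cards1.
rewrite eqEsubset sub1set !inE uvD eqxx andbT => /subsetPn[e].
rewrite !inE => /andP[eD ue] e_neq.
have : #|e :\ u| == 1 by have := D2 e eD; rewrite (cardsD1 u) ue add1n => -[->].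
case/cards1P=> w ewE; have eE : e = [set u; w] by rewrite -(setD1K ue) ewE.
exists w; rewrite -?eE //; apply/andP; split.
  by have := set11 w; rewrite -ewE !inE => /andP[].
by apply: contraNneq e_neq => <-; rewrite eE.
Qed.

Lemma even_edges_cycle D : (forall e, e \in D -> #|e| = 2) ->
  even_edges D -> D != set0 ->
  exists s, [/\ uniq s, 2 < size s & cycle_edges s \subset D].
Proof.
move=> D2 evD /set0Pn[e0 e0D]; pose r u v := [set u; v] \in D.
suff [s [s_uniq s_size s_cycle]] : exists s, [/\ uniq s, 2 < size s & cycle r s].
  exists s; split=> //; apply/subsetP => _ /imsetP[u us ->].
  exact: next_cycle s_cycle us.
(* Paths are extended at the head [x], in place of choosing a longest one. The second alternative is
   impossible for [n = #|W|], as the path would have more vertices than [W]. *)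
have grow n : (exists s, [/\ uniq s, 2 < size s & cycle r s]) \/
    exists x p, [/\ size p = n.+1, uniq (x :: p) & path r x p].
  elim: n => [|n [|[x [p [p_size xp_uniq xp_path]]]]]; last 2 first.
  - by left.
  - case: p p_size xp_uniq xp_path => // y p p_size xp_uniq xp_path.
    have xyD : [set x; y] \in D by case/andP: xp_path.
    have [z xzD /andP[zx zy]] := second_neighbour D2 evD xyD.
    have [zp|zp] := boolP (z \in x :: y :: p); last first.
      right; exists z, (x :: y :: p); split; first by rewrite -p_size.
        by rewrite cons_uniq zp.
      by rewrite /= {1}/r setUC xzD.
    (* Here [z] lies on the path beyond [y], so the prefix from [x] to [z] has at least three
       vertices and the edge between [z] and [x] closes it. *)
    left; move: zp; rewrite inE (negbTE zx) inE (negbTE zy) /= => zp.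
    case/splitPr: zp xp_uniq xp_path {p_size} => p1 p2 xp_uniq xp_path.
    exists (x :: y :: rcons p1 z); split=> //.
    + by move: xp_uniq; rewrite -cat_rcons -!cat_cons cat_uniq => /and3P[].
    + by rewrite /= size_rcons.
    + move: xp_path; rewrite -cat_rcons -!cat_cons cat_path => /andP[xp_path _].
      by rewrite /cycle rcons_path xp_path /= last_rcons /r setUC.
  have /eqP/cards2P[x [y [xy eE]]] := D2 _ e0D.
  by right; exists x, [:: y]; split; rewrite //= ?inE ?xy // andbT /r -eE.
have [//|[x [p [p_size xp_uniq _]]]] := grow #|W|.
by have := max_card (mem (x :: p));
  rewrite (card_uniqP xp_uniq) /= p_size ltnNge leqnSn.
Qed.

End CycleEdges.

(** * Counting cycles of complete bipartite graphs *)

Section BipartiteCycles.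
Variables (W : finType) (col : {set W}).
Implicit Types (s x y : seq W) (C D : {set {set W}}).

Definition bichromatic_edges : {set {set W}} :=
  [set [set u; v] | u in col, v in ~: col].

(** A simple cycle has as many vertices as edges; fixing the length of the vertex list at [#|C|]
    makes the existential range over a finite type. *)
Definition bichromatic_cycles : {set {set {set W}}} :=
  [set C : {set {set W}} | (C \subset bichromatic_edges) &&
    [exists s : #|C|.-tuple W, [&& uniq s, 2 < #|C| & cycle_edges s == C]]].

Lemma card_bichromatic_edge e : e \in bichromatic_edges -> #|e| = 2.
Proof.
case/imset2P=> u v; rewrite inE => uc vc ->; rewrite cards2.
by rewrite (_ : u != v) //; apply: contraNneq vc => <-.
Qed.

Lemma bichromatic_edge_col u v : [set u; v] \in bichromatic_edges ->
  (v \in col) = (u \notin col).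
Proof.
move=> uv; have := card_bichromatic_edge uv.
case/imset2P: uv => a b ac; rewrite inE => bc E; rewrite cards2.
case: eqVneq => // uv _.
have := set21 u v; have := set22 u v; rewrite E !inE.
by move=> /orP[]/eqP vE /orP[]/eqP uE; move: uv;
  rewrite uE vE ?eqxx // ac (negbTE bc).
Qed.

Lemma bichromatic_cyclesP C : reflect
  (exists s, [/\ uniq s, 2 < size s, cycle_edges s = C &
     C \subset bichromatic_edges])
  (C \in bichromatic_cycles).
Proof.
rewrite inE; apply: (iffP andP).
  by case=> CB /existsP[s /and3P[? ? /eqP ?]]; exists s; rewrite size_tuple.
case=> s [s_uniq s_size sE CB]; split=> //; apply/existsP.
have sz : size s == #|C| by rewrite -sE card_cycle_edges.
by exists (Tuple sz); rewrite /= s_uniq sE eqxx -(eqP sz) s_size.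
Qed.

Lemma bichromatic_cycle_sub D : D \subset bichromatic_edges ->
  even_edges D -> D != set0 ->
  exists2 C, C \in bichromatic_cycles & C \subset D.
Proof.
move=> /subsetP DB evD D0.
have [s [s_uniq s_size sD]] :=
  even_edges_cycle (fun e eD => card_bichromatic_edge (DB e eD)) evD D0.
exists (cycle_edges s) => //; apply/bichromatic_cyclesP; exists s; split=> //.
exact: subset_trans sD (introT subsetP DB).
Qed.

Lemma bichromatic_cycle_even C : C \in bichromatic_cycles -> even_edges C.
Proof. by case/bichromatic_cyclesP=> s [? ? <- _]; apply: even_cycle_edges. Qed.

Lemma bichromatic_cycle_gt2 C : C \in bichromatic_cycles -> 2 < #|C|.
Proof. by case/bichromatic_cyclesP=> s [? ? <- _]; rewrite card_cycle_edges. Qed.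

Lemma even_edges_partition D : D \subset bichromatic_edges -> even_edges D ->
  exists2 P : {set {set {set W}}}, P \subset bichromatic_cycles & partition P D.
Proof.
have [n] := ubnP #|D|; elim: n D => // n IHn D /ltnSE Dn DB evD.
have [->|D0] := eqVneq D set0.
  exists set0; first exact: sub0set.
  by rewrite /partition /cover /trivIset /cover !big_set0 cards0 inE !eqxx.
have [C Ccyc CD] := bichromatic_cycle_sub DB evD D0.
have C0 : C != set0 by rewrite -card_gt0 (leq_trans _ (bichromatic_cycle_gt2 Ccyc)).
have [|||P PC Ppart] := IHn (D :\: C).
- apply: leq_trans Dn.
  by rewrite cardsD (setIidPr CD) ltn_subrL !card_gt0 C0 D0.
- exact: subset_trans (subsetDl _ _) DB.
- by apply: even_edgesD => //; apply: bichromatic_cycle_even.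
exists (C |: P); first by rewrite subUset sub1set Ccyc.
have [/eqP covP trivP P0] := and3P Ppart.
have [|//|//|trivCP CnP] := @trivIsetU1 _ C P.
  move=> B BP; rewrite disjoint_sym.
  have: B \subset D :\: C by rewrite -covP (bigcup_sup B).
  by rewrite subsetD => /andP[].
rewrite /partition trivCP !inE negb_or /= (eq_sym set0) C0 P0 !andbT.
by rewrite /cover big_setU1 //= -/(cover P) covP
  -[X in _ == X](setID D C) (setIidPr CD).
Qed.

Fixpoint interleave x y :=
  if (x, y) is (u :: x', v :: y') then u :: v :: interleave x' y' else [::].

(** Colours alternate along the path, so [x] takes the first, third, ... vertices and [y] the
    others. The [perm_eq] part serves to pass uniqueness from [s] to [x] and [y]. *)
Lemma alternating_interleave k s : size s = k.*2 ->
  (if s is u :: s' then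
     (u \in col) && path [rel u v | [set u; v] \in bichromatic_edges] u s'
   else true) ->
  exists x y, [/\ size x = k, size y = k, all (mem col) x,
    all (mem (~: col)) y & s = interleave x y /\ perm_eq s (x ++ y)].
Proof.
elim: k s => [|k IHk] [|u [|v s]] //=; first by exists [::], [::].
rewrite doubleS => -[s_size] /and3P[uc uv s_path].
have vc : v \notin col by rewrite (bichromatic_edge_col uv) uc.
have [|x [y [xk yk xc yc [-> pxy]]]] := IHk s s_size.
  case: s s_path {s_size} => //= w s /andP[vw ->].
  by rewrite (bichromatic_edge_col vw) vc.
exists (u :: x), (v :: y); split; rewrite /= ?xk ?yk ?uc ?xc ?yc ?inE ?vc //.
split=> //; rewrite perm_cons (perm_trans _ (permEl (perm_catCA [:: v] x y))) //.
by rewrite /= perm_cons.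
Qed.

Lemma cycle_edges_start C e : C \in bichromatic_cycles -> e \in C ->
  exists u v s, [/\ uniq [:: u, v & s], size [:: u, v & s] = #|C|, u \in col,
    e = [set u; v] & cycle_edges [:: u, v & s] = C].
Proof.
(* Rotating [s] brings [e] to the front; if it is then traversed towards [col],
   the cycle is reversed. *)
case/bichromatic_cyclesP=> s [s_uniq s_size sC CB] eC.
have /imsetP[u us eE] : e \in cycle_edges s by rewrite sC.
have [i s' rotE] := rot_to us.
have: cycle_edges (u :: s') = C by rewrite -rotE cycle_edges_rot.
have: uniq (u :: s') by rewrite -rotE rot_uniq.
have: size (u :: s') = #|C| by rewrite -rotE size_rot -sC card_cycle_edges.
have: 2 < size (u :: s') by rewrite -rotE size_rot.
have: e = [set u; next (u :: s') u] by rewrite -rotE next_rot.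
case: s' {rotE} => [|v s'] //=; rewrite eqxx => evE _ t_size t_uniq tC.
have [uc|uc] := boolP (u \in col); first by exists u, v, s'.
have vc : v \in col.
  by rewrite (@bichromatic_edge_col u) // -evE (subsetP CB).
(* Rotating by two moves [u] and [v] to the end, so that the reversed list starts with [v], [u]. *)
have revE : rev (rot 2 [:: u, v & s']) = [:: v, u & rev s'].
  by rewrite /rot /= drop0 take0 rev_cat.
have rev_s_uniq : uniq [:: v, u & rev s'] by rewrite -revE rev_uniq rot_uniq.
exists v, u, (rev s'); split=> //.
- by rewrite size_rev.
- by rewrite setUC.
- by rewrite -revE cycle_edges_rev ?rot_uniq // cycle_edges_rot.
Qed.

Lemma last_alternating s u :
  path [rel u v | [set u; v] \in bichromatic_edges] u s ->
  (last u s \in col) = (u \in col) (+) odd (size s).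
Proof.
elim: s u => [|v s IHs] u /=; first by rewrite addbF.
by case/andP=> uv /IHs->; rewrite (bichromatic_edge_col uv) addNb addbN.
Qed.

(** A traversal starts with [e] at its end in [col]. The first two vertices therefore recover [e],
    and the pair [(C, e)] is determined by [x] and [y]. *)
Lemma bichromatic_cycle_interleave C e : C \in bichromatic_cycles -> e \in C ->
  exists k x y, [/\ #|C| = k.*2, size x = k /\ size y = k,
    all (mem col) x /\ uniq x, all (mem (~: col)) y /\ uniq y &
    (C, e) = (cycle_edges (interleave x y),
              [set u in take 2 (interleave x y)])].
Proof.
move=> Ccyc eC; have [u [v [s [s_uniq sz uc eE sC]]]] := cycle_edges_start Ccyc eC.
have CB : C \subset bichromatic_edges by case/bichromatic_cyclesP: Ccyc => ? [].
have s_cycle : cycle [rel u v | [set u; v] \in bichromatic_edges] [:: u, v & s].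
  apply: cycle_from_next => // w ws; apply: (subsetP CB).
  by rewrite -sC; apply/imsetP; exists w.
move: s_cycle; rewrite (cycle_path u) [last _ _]/= => s_cycle.
have s_path : path [rel u v | [set u; v] \in bichromatic_edges] u (v :: s).
  by case/andP: s_cycle.
(* The closing edge returns to [u], which is in [col], so the last vertex is not in [col] and the
   number of steps from [u] to it is odd. *)
have s_odd : odd (size (v :: s)).
  have := last_alternating s_path; case/andP: s_cycle => /bichromatic_edge_col.
  by rewrite uc => /esym/negbTE -> _ /esym/negbFE.
set k := (size s)./2.+1.
have szk : size [:: u, v & s] = k.*2.
  by rewrite /k doubleS /= -[in LHS](odd_double_half (size s));
    move: s_odd => /= /negbTE->.
have [|x [y [xk yk xc yc [sE sxy]]]] := @alternating_interleave k [:: u, v & s] szk.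
  by rewrite uc.
move: s_uniq; rewrite (perm_uniq sxy) cat_uniq => /and3P[x_uniq _ y_uniq].
exists k, x, y; split; rewrite -?sz //; rewrite -sE sC eE; congr (_, _).
by apply/setP => w; rewrite /= take0 !inE.
Qed.

(** Flags, that is pairs of a cycle and one of its edges, are counted in two ways. That [f] reaches
    every flag suffices for an upper bound. *)
Lemma card_bichromatic_cycles k :
  #|[set C in bichromatic_cycles | #|C| == k.*2]| * k.*2 <=
    (#|col| ^_ k) * (#|~: col| ^_ k).
Proof.
set Ck := [set C in _ | _].
pose X (c : {set W}) := [set t : k.-tuple W | all (mem c) t & uniq t].
pose f (xy : k.-tuple W * k.-tuple W) := (cycle_edges (interleave xy.1 xy.2),
  [set u in take 2 (interleave xy.1 xy.2)]).
pose flags := [set Ce : {set {set W}} * {set W} | (Ce.1 \in Ck) && (Ce.2 \in Ce.1)].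
have <- : #|flags| = #|Ck| * k.*2.
  rewrite -sum1_card.
  rewrite (eq_bigl (fun Ce => (Ce.1 \in Ck) && (Ce.2 \in Ce.1))); last first.
    by move=> Ce; rewrite inE.
  rewrite -(pair_big_dep (mem Ck) (fun C e => e \in C) (fun _ _ => 1)) /=.
  rewrite -sum_nat_const; apply: eq_bigr => C.
  by rewrite inE sum1_card => /andP[_ /eqP].
have <- : #|setX (X col) (X (~: col))| = #|col| ^_ k * #|~: col| ^_ k.
  by rewrite cardsX /X !card_uniq_tuples.
apply: leq_trans (leq_imset_card f _); apply: subset_leq_card.
apply/subsetP => -[C e].
rewrite inE => /andP[/setIdP[/= Ccyc /eqP Ck2] eC].
have [k' [x [y]]] := bichromatic_cycle_interleave Ccyc eC.
rewrite Ck2 => -[/double_inj <- [xk yk] [xc x_uniq] [yc y_uniq] ->].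
apply/imsetP; exists (Tuple (introT eqP xk), Tuple (introT eqP yk)) => //.
by rewrite inE !inE /= xc x_uniq yc.
Qed.
End BipartiteCycles.

(** * Counting families by size profile *)

Section SubsetsByProfile.
Variables (T : finType) (S : {set T}) (sz : T -> nat) (K : nat) (len : nat -> nat).
Hypothesis len_gt0 : forall k, 0 < len k.
Hypothesis len_inj : injective len.
Hypothesis szP : forall C, C \in S -> exists k : 'I_K, sz C = len k.
Implicit Types P : {set T}.

Definition size_class (k : nat) : {set T} := [set C in S | sz C == len k].

Lemma sum_size_class P : P \subset S ->
  \sum_(C in P) sz C = \sum_(k < K) len k * #|P :&: size_class k|.
Proof.
move=> /subsetP PS.
have -> : \sum_(C in P) sz C =
    \sum_(C in P) \sum_(k < K | sz C == len k) len k.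
  apply: eq_bigr => C /PS/szP[k ->]; rewrite (big_pred1 k) // => j /=.
  by rewrite (inj_eq len_inj) eq_sym.
rewrite (exchange_big_dep xpredT) //=; apply: eq_bigr => k _.
rewrite sum_nat_const mulnC; congr (_ * _); apply: eq_card => C.
by rewrite !inE unfold_in; case: (boolP (C \in P)) => //= CP; rewrite PS.
Qed.

(** By [szP] the size classes cover [S], so [P] is the union of its traces on them, and each trace
    is one of the [a k]-element subsets of its class. *)
Lemma card_subsets_profile (w : nat) (a : {ffun 'I_K -> 'I_w.+1}) :
  #|[set P : {set T} | (P \subset S) &&
      [forall k : 'I_K, #|P :&: size_class k| == a k]]|
    <= \prod_(k < K) 'C(#|size_class k|, a k).
Proof.
set Pa := [set P | _].
pose F (k : 'I_K) := [set Q : {set T} | Q \subset size_class k & #|Q| == a k].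
have -> : \prod_(k < K) 'C(#|size_class k|, a k) = #|setXn F|.
  by rewrite cardsXn; apply: eq_bigr => k _; rewrite cards_draws.
pose f P : {dffun forall k : 'I_K, {set T}} :=
  [ffun k : 'I_K => P :&: size_class k].
have f_inj : {in Pa &, injective f}.
  suff PE P : P \in Pa -> P = \bigcup_k f P k.
    move=> P Q PPa QPa /ffunP fE; rewrite (PE P) // (PE Q) //.
    by apply: eq_bigr => k _; rewrite fE.
  rewrite inE => /andP[/subsetP PS _]; apply/setP => C; apply/idP/bigcupP.
    move=> CP; have CS : C \in S by apply: PS.
    have [k kE] := szP CS.
    by exists k; rewrite // ffunE !inE CP CS kE eqxx.
  by case=> k _; rewrite ffunE !inE => /andP[].
rewrite -(card_in_imset f_inj); apply: subset_leq_card.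
apply/subsetP => _ /imsetP[P PPa ->].
move: PPa; rewrite inE => /andP[_ /forallP Pa_k]; apply/setXnP => k.
by rewrite inE ffunE subsetIr Pa_k.
Qed.

Lemma card_subsets_by_profile (w : nat) :
  #|[set P : {set T} | (P \subset S) && (\sum_(C in P) sz C == w)]| <=
    \sum_(a : {ffun 'I_K -> 'I_w.+1} | \sum_(k < K) len k * a k == w)
      \prod_(k < K) 'C(#|size_class k|, a k).
Proof.
set Pw := [set P | _].
(* The default of [inord] is never reached on [Pw]: since [len k] is positive, each count is at most
   the total size [w]. *)
pose prof P : {ffun 'I_K -> 'I_w.+1} :=
  [ffun k : 'I_K => inord #|P :&: size_class k|].
have profE P k : P \in Pw -> prof P k = #|P :&: size_class k| :> nat.
  rewrite inE => /andP[PS /eqP Pwt].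
  rewrite ffunE inordK // ltnS -Pwt sum_size_class //.
  by rewrite (bigD1 k) //= (leq_trans _ (leq_addr _ _)) // leq_pmull.
rewrite -sum1_card.
rewrite (partition_big prof (fun a => \sum_(k < K) len k * a k == w)) /=; last first.
  move=> P PPw; have := PPw; rewrite inE => /andP[PS /eqP Pwt].
  rewrite -[X in _ == X]Pwt sum_size_class //; apply/eqP; apply: eq_bigr => k _.
  by rewrite profE.
apply: leq_sum => a _; rewrite sum1dep_card.
apply: leq_trans (card_subsets_profile a); apply: subset_leq_card.
apply/subsetP => P /setIdP[PPw /eqP <-].
rewrite inE; have := PPw; rewrite inE => /andP[-> _] /=.
by apply/forallP => k; rewrite profE.
Qed.

End SubsetsByProfile.

(** * * Even edge sets of balanced complete bipartite graphs *)

Lemma cyc_lenE k : cyc_len k = k.+2.*2.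
Proof. by rewrite /cyc_len !doubleS -mul2n !addnS addn0. Qed.

(** Choosing one cycle partition for each [D] is injective, because [D] is the union of the parts;
    the sizes of the parts add up to [w]. *)
Lemma card_even_bichromatic (W : finType) (col : {set W}) (t w : nat) :
  1 < t -> #|col| = 2 * t -> #|~: col| = 2 * t ->
  #|[set D : {set {set W}} |
      [&& D \subset bichromatic_edges col, even_edges D & #|D| == w]]| <=
    \sum_(a in weight_profiles t w)
      \prod_(k < (2 * t).-1) 'C(Air t (cyc_len k), a k).
Proof.
move=> t_gt1 col_t colC_t; set Ew := [set D | _].
set cyc := bichromatic_cycles col.
pose decomp D : {set {set {set W}}} :=
  odflt set0 [pick P : {set {set {set W}}} | (P \subset cyc) && partition P D].
have decompP D : D \in Ew -> decomp D \subset cyc /\ partition (decomp D) D.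
  rewrite inE => /and3P[DB evD _]; rewrite /decomp.
  case: pickP => [P /andP[]//|noP].
  by have [P PC PD] := even_edges_partition DB evD; have := noP P; rewrite PC PD.
have decomp_inj : {in Ew &, injective decomp}.
  move=> D D' /decompP[_ /cover_partition DE] /decompP[_ /cover_partition DE'] E.
  by rewrite -DE -DE' E.
have cyc_size C : C \in cyc -> exists k : 'I_(2 * t).-1, #|C| = cyc_len k.
  move=> Ccyc; have C_gt2 := bichromatic_cycle_gt2 Ccyc.
  have /card_gt0P[e eC] : 0 < #|C| by apply: leq_trans C_gt2.
  have [k [x [_ [CE [xk _] [/allP xc x_uniq] _ _]]]] :=
    bichromatic_cycle_interleave Ccyc eC.
  (* The [k] distinct vertices of [x] lie in [col]. Together with [1 < k] this puts the index
     [k - 2] in range. *)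
  have k_le : k <= 2 * t.
    rewrite -xk -col_t -(card_uniqP x_uniq).
    by apply/subset_leq_card/subsetP => u /xc.
  have k_gt1 : 1 < k by move: C_gt2; rewrite CE; case: (k) => [|[]].
  have k_lt : k - 2 < (2 * t).-1.
    by rewrite -subn1 ltn_subRL addnBA // add1n subSS subn1 prednK // ltnW.
  by exists (Ordinal k_lt); rewrite CE cyc_lenE /= -addn2 subnK.
have cyc_len_inj : injective cyc_len.
  by move=> i j; rewrite !cyc_lenE => /double_inj[].
have cyc_len_gt0 k : 0 < cyc_len k by rewrite cyc_lenE.
rewrite -(card_in_imset decomp_inj).
apply: (@leq_trans #|[set P : {set {set {set W}}} |
    (P \subset cyc) && (\sum_(C in P) #|C| == w)]|).
  apply: subset_leq_card; apply/subsetP => _ /imsetP[D DE ->].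
  have [decompS /card_partition decompE] := decompP D DE.
  rewrite inE decompS -decompE.
  by move: DE; rewrite inE => /and3P[].
apply: leq_trans (card_subsets_by_profile cyc_len_gt0 cyc_len_inj cyc_size w) _.
have in_profiles a : (a \in weight_profiles t w) =
    (\sum_(k < (2 * t).-1) cyc_len k * a k == w) by rewrite inE.
rewrite [leqRHS](eq_bigl _ _ in_profiles).
apply: leq_sum => a _; apply: leq_prod => k _; apply: leq_bin2l.
(* The quotient in [Air] is cleared, which leaves the flag count with [k.+2] vertices of each
   colour. *)
rewrite /Air leq_divRL ?cyc_len_gt0 //.
have := card_bichromatic_cycles col k.+2.
rewrite /size_class cyc_lenE => /leq_trans-> //.
rewrite col_t colC_t doubleK big_mkord ffact_prod mulnn.
by rewrite -(big_morph (expn^~ 2) (fun x y => expnMn x y 2) (exp1n 2)).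
Qed.

Lemma card_odd_ord n : #|[set i : 'I_n.*2 | odd i]| = n.
Proof.
rewrite -sum1dep_card big_mkcond /=.
rewrite -(big_mkord xpredT (fun i => if odd i then 1 else 0)).
elim: n => [|n IHn]; first by rewrite big_nil.
by rewrite doubleS !big_nat_recr //= IHn odd_double addn0 addn1.
Qed.

(** * Codewords as even edge sets *)

Section TannerGraph.
Variables (r n : nat) (H : 'M['F_2]_(r, n)).
Hypothesis pcmH : base_pcm H.

Definition column_support (j : 'I_n) : {set 'I_r} := [set i | H i j != 0%R].

Definition codeword_edges (c : 'rV['F_2]_n) : {set {set 'I_r}} :=
  [set column_support j | j in [set j | c ord0 j != 0%R]].

Lemma F2_neq0_inj (a b : 'F_2) : (a != 0%R) = (b != 0%R) -> a = b.
Proof. by case: a b => [[|[|//]] a2] [[|[|//]] b2] // _; apply: val_inj. Qed.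

Lemma F2_neq0_natr (a : 'F_2) : a = (a != 0%R)%:R%R.
Proof. by case: a => [[|[|//]] a2]; apply: val_inj. Qed.

Lemma column_support_inj : injective column_support.
Proof.
move=> j k /setP E; apply: pcmH.1; apply/colP => i; rewrite !mxE.
by apply: F2_neq0_inj; have := E i; rewrite !inE.
Qed.

(** An odd difference of the two indices means that exactly one of them is odd. *)
Lemma column_support_bichromatic j :
  column_support j \in bichromatic_edges [set i : 'I_r | odd i].
Proof.
have [H2 Hodd] : odd_gap_pair (col j H) by apply/pcmH.2; exists j.
have /eqP/cards2P[x [y [xy jE]]] : #|column_support j| = 2.
  by rewrite -[RHS]H2; apply: eq_card => i; rewrite !inE !mxE.
have odd_xy : odd x (+) odd y.
  have Hx : H x j != 0%R by have := set21 x y; rewrite -jE inE.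
  have Hy : H y j != 0%R by have := set22 x y; rewrite -jE inE.
  have := Hodd x y; have := Hodd y x; rewrite !mxE => oyx oxy.
  have [xy_lt|yx_lt|/val_inj xyE] := ltngtP x y; last by rewrite xyE eqxx in xy.
  - by have := oxy Hx Hy xy_lt; rewrite oddB 1?addbC // ltnW.
  - by have := oyx Hy Hx yx_lt; rewrite oddB // ltnW.
have [ox|ox] := boolP (odd x).
  by apply/imset2P; exists x y; rewrite ?inE //; move: odd_xy; rewrite ox.
apply/imset2P; exists y x; rewrite ?inE //; last by rewrite setUC.
by move: odd_xy; rewrite (negbTE ox).
Qed.

Lemma codeword_edges_inj : injective codeword_edges.
Proof.
move=> c d /(imset_inj column_support_inj)/setP E; apply/rowP => j.
by apply: F2_neq0_inj; have := E j; rewrite !inE.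
Qed.

Lemma card_codeword_edges c : #|codeword_edges c| = hweight c.
Proof. by rewrite card_imset //; apply: column_support_inj. Qed.

(** Modulo 2, the degree of node [i] is the [i]-th entry of the syndrome [H *m c^T], which
    vanishes. *)
Lemma even_codeword_edges c : c \in code_of H -> even_edges (codeword_edges c).
Proof.
rewrite inE => /eqP/colP Hc; apply/forallP => i; rewrite /vertex_degree.
have -> : [set e in codeword_edges c | i \in e] =
    column_support @: [set j | (H i j != 0%R) && (c ord0 j != 0%R)].
  apply/setP => e; rewrite inE; apply/andP/imsetP.
    case=> /imsetP[j]; rewrite inE => cj ->; rewrite inE => Hij.
    by exists j => //; rewrite inE Hij.
  case=> j; rewrite inE => /andP[Hij cj] ->; rewrite inE; split=> //.
  by apply/imsetP; exists j; rewrite ?inE.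
rewrite card_imset; last exact: column_support_inj.
(* In characteristic 2, evenness of the degree becomes the vanishing of its image in ['F_2], to be
   compared with row [i] term by term. *)
rewrite -dvdn2 (GRing.dvdn_pcharf (pchar_Fp (isT : prime 2))).
have := Hc i; rewrite !mxE => Hci; rewrite -[X in _ == X]Hci.
rewrite -sum1dep_card GRing.natr_sum big_mkcond; apply/eqP/eq_bigr => j _ /=.
rewrite mxE [RHS](_ : _ = ((H i j != 0%R) && (c ord0 j != 0%R))%:R%R).
  by case: (_ && _).
by rewrite -mulnb GRing.natrM -!F2_neq0_natr.
Qed.

End TannerGraph.

Theorem proposition4 (t n : nat) (ht : 2 <= t) (hn : n = 4 * t ^ 2)
    (H : 'M['F_2]_(4 * t, n)) (hH : base_pcm H)
    (w : nat) (hw0 : 0 < w) (hwn : w <= n) :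
  num_codewords (code_of H) w <=
    \sum_(a in weight_profiles t w)
      \prod_(k < (2 * t).-1) 'C(Air t (cyc_len k), a k).
Proof.
pose odd_nodes : {set 'I_(4 * t)} := [set i : 'I_(4 * t) | odd i].
have odd_card : #|odd_nodes| = 2 * t.
  rewrite /odd_nodes; have -> : 4 * t = (2 * t).*2 by rewrite -mul2n mulnA.
  exact: card_odd_ord.
have even_card : #|~: odd_nodes| = 2 * t.
  apply: (@addnI #|odd_nodes|).
  by rewrite cardsC odd_card card_ord addnn -mul2n mulnA.
apply: leq_trans (card_even_bichromatic w ht odd_card even_card).
rewrite /num_codewords -(card_imset _ (codeword_edges_inj hH)).
apply: subset_leq_card; apply/subsetP => _ /imsetP[c cw ->].
have /setIdP[cH /eqP <-] := cw.
rewrite inE card_codeword_edges // eqxx even_codeword_edges // !andbT.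
by apply/subsetP => _ /imsetP[j _ ->]; apply: column_support_bichromatic.
Qed.
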